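(* Let $n\ge 2$, let $\mathcal B$ be the unitary basis $\{u_{\varepsilon_1,\dots,\varepsilon_{[n/2]}}\}$ of $\Delta_n$, let $\gamma_n$ be the real or quaternionic structure of $\Delta_n$, and let $$\phi_0=\sum_{\psi\in\mathcal B}\psi\otimes\gamma_n(\psi)\in\Delta_n\otimes\Delta_n .$$ Then the 2-forms associated to $\phi_0$ are multiples of the elements of the standard basis of $\mathfrak{so}(n)$: for all $1\le p<q\le n$, $$\eta^{\phi_0}_{pq}=2^{[n/2]}\,e_p\wedge e_q .$$
   Context: Clifford representation: with $Id$ the $2\times2$ identity, $g_1=\begin{pmatrix} i&0\\0&-i\end{pmatrix}$, $g_2=\begin{pmatrix}0&i\\ i&0\end{pmatrix}$, $T=\begin{pmatrix}0&-i\\ i&0\end{pmatrix}$, $k=[n/2]$ and $\Delta_n=(\mathbb C^2)^{\otimes k}$, the Clifford algebra generated by the standard orthonormal basis $e_1,\dots,e_n$ of $\mathbb R^n$ ($e_ie_j+e_je_i=-2\delta_{ij}$) acts by $e_{2j-1}\mapsto Id^{\otimes(k-j)}\otimes g_1\otimes T^{\otimes(j-1)}$, $e_{2j}\mapsto Id^{\otimes(k-j)}\otimes g_2\otimes T^{\otimes(j-1)}$ for $1\le j\le k$, and, if $n=2k+1$, $e_{2k+1}\mapsto i\,T^{\otimes k}$. Basis: $u_{+1}=\frac1{\sqrt2}(1,-i)$, $u_{-1}=\frac1{\sqrt2}(1,i)$, $u_{\varepsilon_1,\dots,\varepsilon_k}=u_{\varepsilon_1}\otimes\cdots\otimes u_{\varepsilon_k}$,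 $\varepsilon_j=\pm1$, a unitary basis for the standard Hermitian product. Structures: on $\mathbb C^2$, $\alpha(z_1,z_2)=(-\bar z_2,\bar z_1)$ and $\beta(z_1,z_2)=(\bar z_1,\bar z_2)$. On $\Delta_n$ (with $k$ now a non-negative integer): $\gamma_n=(\alpha\otimes\beta)^{\otimes 2k}$ if $n=8k,8k+1$; $\gamma_n=\alpha\otimes(\beta\otimes\alpha)^{\otimes 2k}$ if $n=8k+2,8k+3$; $\gamma_n=(\alpha\otimes\beta)^{\otimes(2k+1)}$ if $n=8k+4,8k+5$; $\gamma_n=\alpha\otimes(\beta\otimes\alpha)^{\otimes(2k+1)}$ if $n=8k+6,8k+7$. 2-forms: $\Delta_n\otimes\Delta_n$ is viewed as a twisted spinor space with rank $r=n$ and $m=1$; $f_1,\dots,f_n$ denotes the same ordered orthonormal basis $e_1,\dots,e_n$ of $\mathbb R^n$, renamed because it acts by Clifford multiplication on the second tensor factor (while $e_i$ acts on the first). For $\phi\in\Delta_n\otimes\Delta_n$ and $p\ne q$, $\eta^\phi_{pq}(X,Y)=\mathrm{Re}\langle (X\wedge Y)\cdot f_pf_q\cdot\phi,\phi\rangle$, $X,Y\in\mathbb R^n$, where $X\wedge Y$ acts as $X\cdot Y+\langle X,Y\rangle$ on the first factor. As a 2-form, $(e_p\wedge e_q)(e_s,e_t)=\delta_{ps}\delta_{qt}-\delta_{pt}\delta_{qs}$. *)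

(* Defs.v *)
From HB Require Import structures.
From mathcomp Require Import all_boot all_order all_algebra.
From mathcomp Require Import complex.
From mathcomp Require Import reals.

Set Implicit Arguments.
Unset Strict Implicit.
Unset Printing Implicit Defensive.

Import Order.TTheory GRing.Theory Num.Theory.
Local Open Scope ring_scope.

Section Spinors.
Variable R : rcfType.
Local Notation C := (R[i])%C.
Local Notation "x %:C" := (real_complex R x) : ring_scope.

(* C^J for a finite index set J; the tensor product of C^I and C^J is C^(I * J),
   and (C^2)^{(x) k} is C^J for J the set of maps 'I_k -> 'I_2. Position l of
   'I_k is the l-th tensor factor counted from the left, starting at 0. *)
Definition cspace (J : finType) := {ffun J -> C^o}.

Definition multi_index (k : nat) : finType := {ffun 'I_k -> 'I_2}.

Definition hermdot (J : finType) (phi psi : cspace J) : C :=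
  \sum_(j : J) (phi j : C) * (psi j : C)^*.

Definition tens (I J : finType) (phi : cspace I) (psi : cspace J) :
    cspace (I * J)%type :=
  [ffun ij => phi ij.1 * psi ij.2].

(* A (x) id, for A linear *)
Definition on_left (I J : finType) (A : cspace I -> cspace I)
    (Phi : cspace (I * J)%type) : cspace (I * J)%type :=
  [ffun ij => A [ffun i => Phi (i, ij.2)] ij.1].

(* id (x) A, for A linear *)
Definition on_right (I J : finType) (A : cspace J -> cspace J)
    (Phi : cspace (I * J)%type) : cspace (I * J)%type :=
  [ffun ij => A [ffun j => Phi (ij.1, j)] ij.2].

Definition tens_vec (k : nat) (v : 'I_k -> 'cV[C]_2) : cspace (multi_index k) :=
  [ffun i : {ffun 'I_k -> 'I_2} => \prod_(l < k) v l (i l) 0].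

(* M_0 (x) ... (x) M_(k-1), for a list M of k matrices *)
Definition tens_mx (k : nat) (M : seq 'M[C]_2) (phi : cspace (multi_index k)) :
    cspace (multi_index k) :=
  \sum_(j : {ffun 'I_k -> 'I_2})
    phi j *: tens_vec (fun l => nth 1%:M M l *m delta_mx (j l) 0).

(* s_0 (x) ... (x) s_(k-1), for a list s of k antilinear maps: the antilinear map
   sending each pure tensor of standard basis vectors to the tensor of the images *)
Definition tens_antilin (k : nat) (s : seq ('cV[C]_2 -> 'cV[C]_2))
    (phi : cspace (multi_index k)) : cspace (multi_index k) :=
  \sum_(j : {ffun 'I_k -> 'I_2})
    (phi j : C)^* *: tens_vec (fun l => nth id s l (delta_mx (j l) 0)).

Definition mx22 (a b c d : C) : 'M[C]_2 :=
  \matrix_(i, j) if i == 0 then (if j == 0 then a else b)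
                 else (if j == 0 then c else d).

Definition col2 (a b : C) : 'cV[C]_2 := \col_i (if i == 0 then a else b).

Definition g1 : 'M[C]_2 := mx22 'i%C 0 0 (- 'i%C).
Definition g2 : 'M[C]_2 := mx22 0 'i%C 'i%C 0.
Definition T : 'M[C]_2 := mx22 0 (- 'i%C) 'i%C 0.

Definition alpha (z : 'cV[C]_2) : 'cV[C]_2 := col2 (- (z 1 0)^*) (z 0 0)^*.
Definition beta (z : 'cV[C]_2) : 'cV[C]_2 := col2 (z 0 0)^* (z 1 0)^*.

(* true stands for the sign +1, false for -1 *)
Definition u2 (eps : bool) : 'cV[C]_2 :=
  ((Num.sqrt 2 : R)^-1)%:C *: col2 1 (if eps then - 'i%C else 'i%C).

Section Dimension.
Variable n : nat.
Local Notation k := (n./2).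

Definition Delta := cspace (multi_index k).
Definition Delta2 := cspace (multi_index k * multi_index k)%type.

(* The Clifford action of the basis vector of 'rV_n with (0-based) index a, that
   is of e_(a+1); a+1 = 2j-1 or a+1 = 2j with j = a./2 + 1. *)
Definition cliff_gen (a : 'I_n) (phi : Delta) : Delta :=
  let j := (a./2).+1 in
  if (j <= k)%N then
    tens_mx (nseq (k - j) 1%:M ++ (if odd a then g2 else g1) :: nseq j.-1 T) phi
  else 'i%C *: tens_mx (nseq k T) phi.

Definition cliff (X : 'rV[R]_n) (phi : Delta) : Delta :=
  \sum_(a < n) (X 0 a)%:C *: cliff_gen a phi.

Definition dotv (X Y : 'rV[R]_n) : R := \sum_(a < n) X 0 a * Y 0 a.

Definition wedge_act (X Y : 'rV[R]_n) (phi : Delta) : Delta :=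
  cliff X (cliff Y phi) + (dotv X Y)%:C *: phi.

Definition u_basis (eps : {ffun 'I_k -> bool}) : Delta :=
  tens_vec (fun l => u2 (eps l)).

Definition gamma_factors : seq ('cV[C]_2 -> 'cV[C]_2) :=
  let m := (n %/ 8)%N in
  match (n %% 8)./2 with
  | 0 => flatten (nseq (2 * m) [:: alpha; beta])
  | 1 => alpha :: flatten (nseq (2 * m) [:: beta; alpha])
  | 2 => flatten (nseq (2 * m + 1) [:: alpha; beta])
  | _ => alpha :: flatten (nseq (2 * m + 1) [:: beta; alpha])
  end.

Definition gamma (phi : Delta) : Delta := tens_antilin gamma_factors phi.

Definition eta (Phi : Delta2) (p q : 'I_n) (X Y : 'rV[R]_n) : R :=
  complex.Re (hermdot
    (on_left (wedge_act X Y)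
      (on_right (fun psi => cliff_gen p (cliff_gen q psi)) Phi)) Phi).

Definition stdvec (a : 'I_n) : 'rV[R]_n := delta_mx 0 a.

Definition wedge_form (v w X Y : 'rV[R]_n) : R :=
  dotv v X * dotv w Y - dotv v Y * dotv w X.

Definition phi0 : Delta2 :=
  \sum_(eps : {ffun 'I_k -> bool}) tens (u_basis eps) (gamma (u_basis eps)).

End Dimension.

End Spinors.

Arguments phi0 : clear implicits.
Arguments stdvec R {n} a.

(* Main.v *)
Require Import Defs.
From mathcomp Require Import all_boot all_order all_algebra.
From mathcomp Require Import complex.
From mathcomp Require Import reals.
From mathcomp Require Import ring zify.
Import Order.TTheory GRing.Theory Num.Theory.
Local Open Scope ring_scope.

(** Write E_a for the matrix of Clifford multiplication by the a-th basis vector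
    on the spinor space, and G for the linear part of the real or quaternionic
    structure, gamma psi = G (conj psi).

    The spinor phi0 does not depend on the unitary basis that defines it: for a
    unitary basis the sum of the psi (conj psi)^T is the identity, so that the
    array of coefficients of phi0 is the transpose of G (lemma phi0E).  Pairing
    (A (x) B) phi0 with phi0 is therefore the trace of A G^T B^T (conj G).

    On each tensor factor G is alpha or beta, alternately, and a factor of E_a
    commutes or anticommutes with it.  The signs multiply to (-1)^(k-1), with
    k = [n/2], whatever the generator (gamma_gen), so that gamma commutes with
    every product B of two generators.  As G is unitary, the trace above collapses
    to the trace of A B^*, with B^* the adjoint (hermdot_phi0): the 2-forms of
    phi0 are the real part of the trace form on operators.

    For B = E_p E_q the adjoint is E_q E_p because the generators are
    skew-adjoint, and what remains is the trace of X Y E_q E_p.  It follows from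
    the Clifford relations alone, by the anticommutation argument familiar from
    traces of gamma matrices (mxtrace_clifford4).  The scalar <X, Y> in the action
    of the 2-vector contributes a multiple of the trace of E_q E_p, which is 0. *)

Section Spinors.
Set Implicit Arguments.
Unset Strict Implicit.
Variable R : rcfType.
Local Notation C := (R[i])%C.

(** * Operators on finite-index spinor spaces as matrices *)

Definition adjmx m (A : 'M[C]_m) : 'M[C]_m := map_mx Num.conj A^T.

Lemma adjmxE m (A : 'M[C]_m) i j : adjmx A i j = (A j i)^*.
Proof. by rewrite !mxE. Qed.

Lemma adjmxM m (A B : 'M[C]_m) : adjmx (A *m B) = adjmx B *m adjmx A.
Proof. by rewrite /adjmx trmx_mul map_mxM. Qed.

Section Indexed.
Variable J : finType.

(** Indexing by [enum_val] turns kernels on a finite type into ordinary square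
    matrices, so that products, traces and adjoints can be taken from matrix
    algebra. *)
Definition kermat (f : J -> J -> C) : 'M[C]_#|J| :=
  \matrix_(i, j) f (enum_val i) (enum_val j).

Lemma kermatE f i j : kermat f (enum_rank i) (enum_rank j) = f i j.
Proof. by rewrite mxE !enum_rankK. Qed.

Lemma matrix_rankP (A B : 'M[C]_#|J|) :
  (forall i j : J, A (enum_rank i) (enum_rank j) = B (enum_rank i) (enum_rank j)) ->
  A = B.
Proof.
move=> eqAB; apply/matrixP=> i j.
by have := eqAB (enum_val i) (enum_val j); rewrite !enum_valK.
Qed.

Lemma sum_rank (F : 'I_#|J| -> C) : \sum_i F i = \sum_(j : J) F (enum_rank j).
Proof. by rewrite (reindex (@enum_rank J)) //; apply/onW_bij/enum_rank_bij. Qed.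

Definition represents (A : 'M[C]_#|J|) (f : cspace R J -> cspace R J) : Prop :=
  forall (phi : cspace R J) (i : J),
    f phi i = \sum_j A (enum_rank i) (enum_rank j) * (phi j : C) :> C.

Lemma represents_comp A B f g :
  represents A f -> represents B g -> represents (A *m B) (f \o g).
Proof.
move=> fA gB phi i /=; rewrite fA.
under [LHS]eq_bigr do rewrite gB big_distrr.
rewrite exchange_big; apply: eq_bigr => j _ /=.
by rewrite mxE sum_rank big_distrl; apply: eq_bigr => l _; rewrite mulrA.
Qed.

Lemma represents_add A B f g : represents A f -> represents B g ->
  represents (A + B) (fun phi => f phi + g phi).
Proof.
move=> fA gB phi i; rewrite ffunE fA gB -big_split.
by apply: eq_bigr => j _ /=; rewrite mxE mulrDl.
Qed.

Lemma represents_scale c A f : represents A f ->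
  represents (c *: A) (fun phi => c *: f phi).
Proof.
move=> fA phi i; rewrite ffunE fA [LHS]big_distrr.
by apply: eq_bigr => j _ /=; rewrite mxE mulrA.
Qed.

Lemma represents_id : represents 1%:M id.
Proof.
move=> phi i; rewrite (bigD1 i) //= mxE eqxx mul1r big1 ?addr0 // => j ji.
by rewrite mxE (inj_eq enum_rank_inj) eq_sym (negPf ji) mul0r.
Qed.

Lemma represents_sum (I : finType) (A : I -> 'M[C]_#|J|) f :
  (forall a, represents (A a) (f a)) ->
  represents (\sum_a A a) (fun phi => \sum_a f a phi).
Proof.
move=> fA phi i; rewrite sum_ffunE.
under [LHS]eq_bigr do rewrite fA.
rewrite exchange_big; apply: eq_bigr => j _ /=.
by rewrite summxE big_distrl.
Qed.

(** With a vector of a tensor square read as a matrix P, the operator f (x) g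
    sends P to A P B^T and the Hermitian product is the trace form. *)
Lemma hermdot_on_left_right A B f g (Phi : cspace R (J * J)%type) :
  let P := kermat (fun i j => Phi (i, j) : C) in
  represents A f -> represents B g ->
  hermdot (on_left f (on_right g Phi)) Phi = \tr (A *m P *m B^T *m adjmx P).
Proof.
move=> P fA gB; rewrite /hermdot.
transitivity (\sum_i \sum_j
    (on_left f (on_right g Phi) (i, j) : C) * (Phi (i, j) : C)^*).
  by rewrite pair_bigA; apply: eq_bigr => -[].
rewrite /mxtrace sum_rank; apply: eq_bigr => i _.
rewrite mxE sum_rank; apply: eq_bigr => j _.
rewrite adjmxE kermatE; congr (_ * _).
rewrite ffunE fA -mulmxA mxE sum_rank; apply: eq_bigr => k _; congr (_ * _).
rewrite !ffunE gB mxE sum_rank; apply: eq_bigr => l _.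
by rewrite kermatE ffunE mxE mulrC.
Qed.

End Indexed.

(** * Kronecker products of 2 x 2 matrices *)

Section Kronecker.
Variable k : nat.
Local Notation J := (multi_index k).

Definition kron (M : 'I_k -> 'M[C]_2) : 'M[C]_#|J| :=
  kermat (fun i j : {ffun 'I_k -> 'I_2} => \prod_l M l (i l) (j l)).

Lemma kronE M (i j : {ffun 'I_k -> 'I_2}) :
  kron M (enum_rank (i : J)) (enum_rank (j : J)) = \prod_l M l (i l) (j l).
Proof. by rewrite kermatE. Qed.

Lemma kronM M N : kron M *m kron N = kron (fun l => M l *m N l).
Proof.
apply: matrix_rankP => i j; rewrite [LHS]mxE sum_rank kronE.
under [LHS]eq_bigr do rewrite !kronE -big_split.
rewrite -(bigA_distr_bigA (fun l m => M l (i l) m * N l m (j l))).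
by apply: eq_bigr => l _; rewrite mxE.
Qed.

Lemma eq_kron M N : M =1 N -> kron M = kron N.
Proof.
move=> eqMN; apply: matrix_rankP => i j; rewrite !kronE.
by apply: eq_bigr => l _; rewrite eqMN.
Qed.

Lemma prod_delta (T : eqType) (i j : {ffun 'I_k -> T}) :
  \prod_l (i l == j l)%:R = (i == j)%:R :> C.
Proof.
have [->|/eqP nij] := eqVneq i j.
  by rewrite big1 // => l _; rewrite eqxx.
have [l nl] : exists l, i l != j l.
  apply/existsP; apply: contra_notT nij => /existsPn eij.
  by apply/ffunP => l; apply/eqP; have := eij l; rewrite negbK.
by rewrite (bigD1 l) //= (negPf nl) mul0r.
Qed.

Lemma kronZ (c : 'I_k -> C) (M : 'I_k -> 'M[C]_2) :
  kron (fun l => c l *: M l) = (\prod_l c l) *: kron M.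
Proof.
apply: matrix_rankP => i j; rewrite kronE [RHS]mxE kronE -big_split.
by apply: eq_bigr => l _; rewrite mxE.
Qed.

(** Factorwise relations up to sign multiply to a global relation; exponents are
    kept in nat so that only their sum, and at the end its parity, matters. *)
Lemma kron_sign (s : 'I_k -> nat) (M N : 'I_k -> 'M[C]_2) :
  (forall l, M l = (-1) ^+ s l *: N l) ->
  kron M = (-1) ^+ (\sum_l s l) *: kron N.
Proof. by move=> MN; rewrite -prodrXr -kronZ; apply: eq_kron. Qed.

Lemma kron1 : kron (fun=> 1%:M) = 1%:M.
Proof.
apply: matrix_rankP => i j; rewrite kronE [RHS]mxE (inj_eq enum_rank_inj).
by rewrite -prod_delta; apply: eq_bigr => l _; rewrite mxE.
Qed.

Lemma adj_kron M : adjmx (kron M) = kron (fun l => adjmx (M l)).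
Proof.
apply: matrix_rankP => i j; rewrite adjmxE !kronE rmorph_prod.
by apply: eq_bigr => l _; rewrite adjmxE.
Qed.

Lemma conj_kron M : map_mx Num.conj (kron M) = kron (fun l => map_mx Num.conj (M l)).
Proof.
apply: matrix_rankP => i j; rewrite [LHS]mxE !kronE rmorph_prod.
by apply: eq_bigr => l _; rewrite mxE.
Qed.

Lemma represents_tens_mx (M : seq 'M[C]_2) :
  represents (kron (fun l => nth 1%:M M l)) (@tens_mx R k M).
Proof.
move=> phi i; rewrite sum_ffunE; apply: eq_bigr => j _.
rewrite !ffunE kronE [LHS]mulrC; congr (_ * _).
by apply: eq_bigr => l _; rewrite -colE mxE.
Qed.

End Kronecker.

(** * The tables of 2 x 2 relations *)

Lemma mx22M a b c d a' b' c' d' :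
  mx22 a b c d *m mx22 a' b' c' d' =
  mx22 (a * a' + b * c') (a * b' + b * d') (c * a' + d * c') (c * b' + d * d')
  :> 'M[C]_2.
Proof.
apply/matrixP; case=> [[|[|//]] i]; case=> [[|[|//]] j];
 by rewrite !mxE !big_ord_recl big_ord0 addr0 !mxE.
Qed.

Lemma mx22Z e a b c d :
  e *: mx22 a b c d = mx22 (e * a) (e * b) (e * c) (e * d) :> 'M[C]_2.
Proof.
by apply/matrixP; case=> [[|[|//]] i]; case=> [[|[|//]] j]; rewrite !mxE.
Qed.

Lemma mx22_scalar a : mx22 a 0 0 a = a%:M :> 'M[C]_2.
Proof.
by apply/matrixP; case=> [[|[|//]] i]; case=> [[|[|//]] j]; rewrite !mxE.
Qed.

Lemma adj_mx22 a b c d : adjmx (mx22 a b c d) = mx22 a^* c^* b^* d^* :> 'M[C]_2.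
Proof.
by apply/matrixP; case=> [[|[|//]] i]; case=> [[|[|//]] j]; rewrite !mxE.
Qed.

Lemma conj_mx22 a b c d :
  map_mx Num.conj (mx22 a b c d) = mx22 a^* b^* c^* d^* :> 'M[C]_2.
Proof.
by apply/matrixP; case=> [[|[|//]] i]; case=> [[|[|//]] j]; rewrite !mxE.
Qed.

Lemma conj_i : ('i%C : C)^* = - 'i%C.
Proof. by rewrite [LHS]/=; apply/eqP; rewrite eq_complex /= oppr0 !eqxx. Qed.

Lemma mul_ii : ('i%C : C) * 'i%C = -1.
Proof. by rewrite -expr2 sqr_i. Qed.

Lemma conj_Ni : (- 'i%C : C)^* = 'i%C.
Proof. by rewrite -[RHS]opprK -[in RHS]conj_i; exact: rmorphN. Qed.

Lemma conj_N1 : (-1 : C)^* = -1.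
Proof. by rewrite -[in RHS](conjC1 C); exact: rmorphN. Qed.

(** The linear part of [alpha], in the sense that alpha z = J2 (conj z); the linear
    part of [beta] is the identity. *)
Definition J2 : 'M[C]_2 := mx22 0 (-1) 1 0.

Local Notation g1 := (g1 R). Local Notation g2 := (g2 R). Local Notation T := (T R).

Ltac mx2 := rewrite /Defs.g1 /Defs.g2 /Defs.T /J2 -?mx22_scalar
  ?(mx22M, mx22Z, adj_mx22, conj_mx22, conj_i, conj_Ni, conj_N1, conjC1, conjC0,
    mulr0, mul0r, mulr1, mul1r, mulrN, mulNr, addr0, add0r, opprK, oppr0, mul_ii);
  try done.

Lemma g1_sqr : g1 *m g1 = -1 *: 1%:M. Proof. by mx2. Qed.
Lemma g2_sqr : g2 *m g2 = -1 *: 1%:M. Proof. by mx2. Qed.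
Lemma T_sqr : T *m T = 1%:M. Proof. by mx2. Qed.
Lemma g1_g2 : g1 *m g2 = -1 *: (g2 *m g1). Proof. by mx2. Qed.
Lemma g1_T : g1 *m T = -1 *: (T *m g1). Proof. by mx2. Qed.
Lemma g2_T : g2 *m T = -1 *: (T *m g2). Proof. by mx2. Qed.
Lemma adj_1 : adjmx 1%:M = 1%:M :> 'M[C]_2. Proof. by mx2. Qed.
Lemma adj_g1 : adjmx g1 = -1 *: g1. Proof. by mx2. Qed.
Lemma adj_g2 : adjmx g2 = -1 *: g2. Proof. by mx2. Qed.
Lemma adj_T : adjmx T = T. Proof. by mx2. Qed.
Lemma J_unitary : adjmx J2 *m J2 = 1%:M. Proof. by mx2. Qed.
Lemma conj_g1 : map_mx Num.conj g1 = -1 *: g1. Proof. by mx2. Qed.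
Lemma conj_g2 : map_mx Num.conj g2 = -1 *: g2. Proof. by mx2. Qed.
Lemma conj_T : map_mx Num.conj T = -1 *: T. Proof. by mx2. Qed.
Lemma J_g1 : J2 *m map_mx Num.conj g1 = g1 *m J2. Proof. by mx2. Qed.
Lemma J_g2 : J2 *m map_mx Num.conj g2 = g2 *m J2. Proof. by mx2. Qed.
Lemma J_T : J2 *m map_mx Num.conj T = -1 *: (T *m J2). Proof. by mx2. Qed.

(** * The generators of the Clifford algebra *)

Lemma sum_ltn k h : (\sum_(r < k) (r < h) = minn k h)%N.
Proof. by elim: k => [|k IHk]; rewrite ?big_ord0 ?big_ord_recr /= ?IHk; lia. Qed.

Lemma sum_eqn k h (F : nat -> nat) :
  (\sum_(r < k) (r == h :> nat) * F r = (h < k) * F h)%N.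
Proof.
elim: k => [|k IHk]; rewrite ?big_ord0 ?big_ord_recr /= ?IHk //.
by have [->|] := eqVneq k h; lia.
Qed.

Lemma sum_rev_ord k (F : nat -> nat) :
  (\sum_(l < k) F (rev_ord l) = \sum_(r < k) F r)%N.
Proof. by rewrite [RHS](reindex_inj rev_ord_inj). Qed.

Section Dimension.
Variable n : nat.
Local Notation k := (n./2).
Local Notation J := (multi_index k).

(** Tensor factors are counted from the right here: the factors of a generator are
    then T below position a./2, g1 or g2 at that position (the pivot) and 1 above
    it.  For odd n the last generator has its pivot at position k, outside the
    range, which leaves T everywhere. *)
Definition gen_factor (a : nat) (l : 'I_k) : 'M[C]_2 :=
  let r : nat := rev_ord l in
  if (a./2 < r)%N then 1%:M
  else if r == a./2 then (if odd a then g2 else g1) else T.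

Definition gen_coef (a : nat) : C := if (a./2 < k)%N then 1 else 'i%C.

Definition gen (a : nat) : 'M[C]_#|J| := gen_coef a *: kron (gen_factor a).

Lemma sum_at_pivot a : (\sum_(l < k) (rev_ord l == a./2 :> nat) = (a./2 < k))%N.
Proof.
rewrite (sum_rev_ord k (fun r => (r == a./2) : nat)).
under eq_bigr do rewrite -[nat_of_bool _]muln1.
by rewrite (sum_eqn _ _ (fun=> 1%N)) muln1.
Qed.

Lemma gen_sqr a : gen a *m gen a = - 1%:M.
Proof.
rewrite /gen -scalemxAl -scalemxAr kronM.
rewrite (@kron_sign _ (fun l => rev_ord l == a./2 :> nat) _ (fun=> 1%:M)).
  rewrite sum_at_pivot kron1 !scalerA /gen_coef; case: ifP => _.
    by rewrite !mul1r scaleN1r.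
  by rewrite mul_ii mulr1 scaleN1r.
move=> l; rewrite /gen_factor; case: ltngtP => _; rewrite ?scale1r ?mul1mx ?T_sqr //.
by case: odd; rewrite ?g1_sqr ?g2_sqr.
Qed.

Lemma adj_gen a : adjmx (gen a) = - gen a.
Proof.
have -> : adjmx (gen a) = (gen_coef a)^* *: adjmx (kron (gen_factor a)).
  by apply/matrixP=> i j; rewrite !mxE rmorphM.
rewrite adj_kron.
rewrite (@kron_sign _ (fun l => rev_ord l == a./2 :> nat) _ (gen_factor a)).
  rewrite sum_at_pivot scalerA /gen -scaleNr /gen_coef; case: ifP => _.
    by rewrite conjC1 mul1r.
  by rewrite conj_i mulr1.
move=> l; rewrite /gen_factor; case: ltngtP => _; rewrite ?scale1r ?adj_1 ?adj_T //.
by case: odd; rewrite ?adj_g1 ?adj_g2.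
Qed.

(** Generators of indices a < b anticommute because exactly one pair of factors
    does, the one at the pivot of a: it faces T when b has a higher pivot, and is
    g1 against g2 when the pivots coincide.  The pivot of a lies in range because a
    is not the last index. *)
Lemma gen_anticomm_lt (a b : nat) : (a < b)%N -> (b < n)%N ->
  gen a *m gen b = - (gen b *m gen a).
Proof.
move=> ab bn; rewrite /gen -!scalemxAl -!scalemxAr !kronM.
rewrite (@kron_sign _ (fun l => rev_ord l == a./2 :> nat) _
  (fun l => gen_factor b l *m gen_factor a l)).
  have -> : (\sum_(l < k) (rev_ord l == a./2 :> nat) = 1)%N.
    by rewrite sum_at_pivot; lia.
  by rewrite expr1 scaleN1r !scalerN !scalerA (mulrC (gen_coef a)).
move=> l; rewrite /gen_factor; set r : nat := rev_ord l.
have := ltngtP (a./2) r; case.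
- by move=> ?; rewrite mul1mx mulmx1 scale1r.
- case: (ltngtP b./2 r) => //=; try lia.
  by rewrite scale1r.
move=> ra; case: (ltngtP b./2 r) => /=; try lia.
  by case: odd; rewrite ?g1_T ?g2_T.
move=> rb; have -> : odd b = true by lia.
have -> : odd a = false by lia.
by rewrite g1_g2.
Qed.

Lemma gen_clifford (a b : 'I_n) :
  gen a *m gen b + gen b *m gen a = - (2 * (a == b)%:R)%:M.
Proof.
have [<-|] := eqVneq a b.
  by rewrite gen_sqr mulr1 -opprD -raddfD.
rewrite mulr0 raddf0 oppr0 neq_ltn => /orP[] ab;
  rewrite (gen_anticomm_lt ab (ltn_ord _)).
  by rewrite addNr.
by rewrite subrr.
Qed.

Lemma represents_gen (a : 'I_n) : represents (gen a) (@cliff_gen R n a).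
Proof.
move=> phi i; rewrite /cliff_gen /gen /gen_coef.
case: ifP => hk.
  rewrite scale1r represents_tens_mx; apply: eq_bigr => j _; congr (_ * _).
  rewrite !kronE; apply: eq_bigr => l _; congr (fun_of_matrix _ _ _).
  rewrite nth_cat size_nseq nth_nseq /gen_factor /=.
  have h2 := ltn_ord l; have [h1|h1] := ltnP l (k - a./2.+1).
    by rewrite ifT //; lia.
  have -> : (a./2 < k - l.+1)%N = false by lia.
  case: eqP => h3.
    by have -> : (l - (k - a./2.+1) = 0)%N by lia.
  have -> : (l - (k - a./2.+1) = (l - (k - a./2.+1)).-1.+1)%N by lia.
  by rewrite /= nth_nseq ifT //; lia.
rewrite (represents_scale _ (represents_tens_mx (nseq k T))).
apply: eq_bigr => j _; congr (_ * _).
rewrite !mxE; congr (_ * _).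
apply: eq_bigr => l _; congr (fun_of_matrix _ _ _).
rewrite nth_nseq ltn_ord /gen_factor /=.
have := ltn_ord l; have := ltn_ord a => ? ?.
have -> : (a./2 < k - l.+1)%N = false by lia.
by rewrite ifF //; lia.
Qed.

(** * The real or quaternionic structure *)

Definition gamma_factor (l : 'I_k) : 'M[C]_2 := if odd l then 1%:M else J2.

Definition gamma_mx : 'M[C]_#|J| := kron gamma_factor.

Lemma gamma_mx_unitary : adjmx gamma_mx *m gamma_mx = 1%:M.
Proof.
rewrite adj_kron kronM -kron1; apply: eq_kron => l; rewrite /gamma_factor.
by case: odd; rewrite ?J_unitary // adj_1 mulmx1.
Qed.

(** The exponent collects a sign from each factor T, a sign from the pivot when it
    faces [beta] (odd position from the left), and the sign of conj 'i = - 'i for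
    the last generator of odd dimension.  A pivot in range at h = a./2 gives h plus
    the parity of k - 1 - h, hence the parity of k - 1; without pivot there are
    k factors T and the coefficient 'i, hence k + 1. *)
Lemma gamma_sign_parity a : (a < n)%N ->
  odd (\sum_(l < k) ((rev_ord l < a./2) + (rev_ord l == a./2 :> nat) * odd l)
       + (k <= a./2)) = ~~ odd k.
Proof.
move=> an; rewrite (_ : (\sum_(l < k) _ = minn k a./2 +
   (a./2 < k) * odd (k - a./2.+1))%N); first by lia.
rewrite big_split /= (sum_rev_ord k (fun r => (r < a./2)%N : nat)) sum_ltn.
congr addn; rewrite -(sum_eqn k a./2 (fun r => odd (k - r.+1))).
rewrite -(sum_rev_ord k (fun r => (r == a./2) * odd (k - r.+1))%N).
apply: eq_bigr => l _; congr (_ * nat_of_bool (odd _))%N.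
by have := ltn_ord l; rewrite /=; lia.
Qed.

(** The sign does not depend on the generator, so it cancels in products of two. *)
Lemma gamma_gen a : (a < n)%N ->
  gamma_mx *m map_mx Num.conj (gen a) = (-1) ^+ k.+1 *: (gen a *m gamma_mx).
Proof.
move=> an; have -> : map_mx Num.conj (gen a) =
    (gen_coef a)^* *: map_mx Num.conj (kron (gen_factor a)).
  by apply/matrixP=> i j; rewrite !mxE rmorphM.
rewrite conj_kron -scalemxAr kronM.
rewrite (@kron_sign _ (fun l => (rev_ord l < a./2) +
  (rev_ord l == a./2 :> nat) * odd l)%N _
  (fun l => gen_factor a l *m gamma_factor l)).
  have -> : (gen_coef a)^* = (-1) ^+ (k <= a./2)%N * gen_coef a.
    rewrite /gen_coef; case: ltnP => _ /=; first by rewrite expr0 conjC1 mulr1.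
    by rewrite expr1 conj_i mulN1r.
  rewrite /gen -scalemxAl kronM !scalerA mulrAC -exprD addnC.
  congr (_ * _ *: _); rewrite -[LHS]signr_odd -[RHS]signr_odd; congr (_ ^+ _).
  exact: congr1 (gamma_sign_parity an).
move=> l; rewrite /gen_factor /gamma_factor; set r : nat := rev_ord l.
case: (ltngtP r a./2) => _; rewrite ?add0n ?addn0 ?mul0n ?mul1n.
- by case: (odd l); rewrite ?J_T // conj_T mul1mx mulmx1.
- by rewrite map_mx1 mulmx1 mul1mx scale1r.
case: (odd l) => /=; rewrite ?mul1mx ?mulmx1 ?expr1 ?scale1r.
  by case: odd; rewrite ?conj_g1 ?conj_g2.
by case: odd; rewrite ?J_g1 ?J_g2.
Qed.

Lemma nth_flatten_pair (A : Type) (x0 x y : A) m l : (l < m.*2)%N ->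
  nth x0 (flatten (nseq m [:: x; y])) l = if odd l then y else x.
Proof.
elim: m l => [|m IHm] [|[|l]] //=; rewrite doubleS !ltnS => /IHm ->.
by rewrite negbK.
Qed.

(** Whatever n is modulo 8, the definition yields one alternating word alpha, beta,
    alpha, and so on, of length k. *)
Lemma nth_gamma_factors (l : 'I_k) :
  nth id (@gamma_factors R n) l = if odd l then @beta R else @alpha R.
Proof.
rewrite /gamma_factors; have := ltn_ord l.
have := divn_eq n 8; have := ltn_pmod n (isT : (0 < 8)%N).
set m := (n %/ 8)%N; set t := (n %% 8)%N => t8 nE lk.
case tE: t./2 => [|[|[|t']]]; try (rewrite nth_flatten_pair //; lia).
  case lE: (l : nat) => [|l'] //=; rewrite nth_flatten_pair; last lia.
  by case: odd.
case lE: (l : nat) => [|l'] //=; rewrite nth_flatten_pair; last lia.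
by case: odd.
Qed.

Lemma gammaE (phi : Delta R n) (i : J) :
  gamma phi i = \sum_j gamma_mx (enum_rank i) (enum_rank j) * (phi j : C)^* :> C.
Proof.
rewrite /gamma sum_ffunE; apply: eq_bigr => j _.
rewrite !ffunE kronE [LHS]mulrC; congr (_ * _).
apply: eq_bigr => l _; rewrite nth_gamma_factors /gamma_factor.
case: odd; rewrite /alpha /beta /J2 !mxE /=.
  move: (i l) (j l); case=> [[|[|//]] ?]; case=> [[|[|//]] ?] /=;
  by rewrite ?conjC0 ?conjC1.
move: (i l) (j l); case=> [[|[|//]] ?]; case=> [[|[|//]] ?] /=;
by rewrite ?conjC0 ?conjC1 ?oppr0.
Qed.

(** * The coefficients of the spinor *)

Lemma u2_resolution (i j : 'I_2) :
  \sum_(e : bool) u2 R e i 0 * (u2 R e j 0)^* = (i == j)%:R.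
Proof.
set s : C := real_complex R (Num.sqrt 2)^-1.
have ss : s * s^* = 2^-1.
  have -> : s^* = s by exact: conjc_real.
  by rewrite -rmorphM -invfM -expr2 sqr_sqrtr ?ler0n //
    rmorphV ?unitfE ?pnatr_eq0 // rmorph_nat.
have uE e l : u2 R e l 0 = s * (if l == 0 then 1 else if e then - 'i%C else 'i%C).
  by rewrite !mxE.
under eq_bigr do rewrite !uE rmorphM mulrACA ss.
rewrite big_bool; move: i j.
case=> [[|[|//]] ?]; case=> [[|[|//]] ?] /=;
rewrite ?conjC1 ?conj_i ?conj_Ni ?mulrN ?mulNr ?opprK ?mul_ii ?mulr1 ?mul1r;
by field.
Qed.

Lemma u_basis_resolution (i j : J) :
  \sum_(eps : {ffun 'I_k -> bool})
     (@u_basis R n eps i : C) * (@u_basis R n eps j : C)^* = (i == j)%:R.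
Proof.
under eq_bigr do rewrite !ffunE rmorph_prod -big_split.
rewrite /= -(bigA_distr_bigA (fun l e => @u2 R e (i l) 0 * (@u2 R e (j l) 0)^*)).
under eq_bigr do rewrite u2_resolution.
exact: prod_delta.
Qed.

(** The resolution of the identity leaves the coefficients of gamma; the indices
    are swapped because gamma acts on the second tensor factor. *)
Lemma phi0E (i j : J) :
  phi0 R n (i, j) = gamma_mx (enum_rank j) (enum_rank i) :> C.
Proof.
transitivity (\sum_(eps : {ffun 'I_k -> bool}) \sum_(m : J)
    gamma_mx (enum_rank j) (enum_rank m) *
    ((@u_basis R n eps i : C) * (@u_basis R n eps m : C)^*)).
  rewrite sum_ffunE; apply: eq_bigr => eps _.
  rewrite ffunE gammaE [LHS]big_distrr; apply: eq_bigr => m _.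
  exact: mulrCA.
rewrite exchange_big (bigD1 i) //= -big_distrr u_basis_resolution eqxx /= mulr1.
rewrite big1 ?addr0 // => m mi.
by rewrite -big_distrr u_basis_resolution eq_sym (negPf mi) /= mulr0.
Qed.

Lemma represents_cliff (X : 'rV[R]_n) :
  represents (\sum_a (X 0 a)%:C%C *: gen a) (cliff X).
Proof. exact: (represents_sum (fun a => represents_scale _ (represents_gen a))). Qed.

Lemma represents_wedge (X Y : 'rV[R]_n) :
  represents ((\sum_a (X 0 a)%:C%C *: gen a) *m (\sum_a (Y 0 a)%:C%C *: gen a)
              + (dotv X Y)%:C%C *: 1%:M) (wedge_act X Y).
Proof.
exact: (represents_add (represents_comp (represents_cliff X) (represents_cliff Y))
                       (represents_scale _ (@represents_id _))).
Qed.

(** Commutation with gamma replaces G^* B G by conj B, which removes G from the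
    trace. *)
Lemma hermdot_phi0 A B f g :
  represents A f -> represents B g ->
  gamma_mx *m map_mx Num.conj B = B *m gamma_mx ->
  hermdot (on_left f (on_right g (phi0 R n))) (phi0 R n) = \tr (A *m adjmx B).
Proof.
move=> fA gB commB; rewrite (hermdot_on_left_right _ fA gB).
have -> : kermat (fun i j => phi0 R n (i, j) : C) = gamma_mx^T.
  by apply: matrix_rankP => i j; rewrite kermatE phi0E [RHS]mxE.
have -> : adjmx gamma_mx^T = (adjmx gamma_mx)^T by rewrite /adjmx map_trmx.
rewrite -!mulmxA -!trmx_mul -mulmxA -commB mulmxA gamma_mx_unitary mul1mx.
by rewrite /adjmx map_trmx.
Qed.

End Dimension.
End Spinors.

(** * Traces of products of Clifford generators *)

Section Trace.
Variables (F : numFieldType) (N n : nat) (e : 'I_n -> 'M[F]_N).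
Hypothesis clifford : forall a b,
  e a *m e b + e b *m e a = - (2 * (a == b)%:R)%:M.

Lemma mxtrace_clifford2 a b : \tr (e a *m e b) = - (N%:R * (a == b)%:R).
Proof.
have := congr1 mxtrace (clifford a b).
rewrite linearD linearN /= mxtrace_scalar [\tr (e b *m _)]mxtrace_mulC => tr2.
apply: (@mulfI _ 2); first by rewrite pnatr_eq0.
by rewrite mulr_natl mulr2n tr2 -mulr_natl; ring.
Qed.

Lemma mxtrace_swap a b (M : 'M[F]_N) :
  \tr (e a *m e b *m M) = - \tr (e b *m e a *m M) - 2 * (a == b)%:R * \tr M.
Proof.
have /(canRL (addrK _)) -> := clifford a b.
by rewrite mulmxDl !mulNmx mul_scalar_mx linearD !linearN linearZ /= addrC.
Qed.

(** Moving the first factor past the three others changes the sign of the trace,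
    up to the contractions given by the Clifford relations, while cyclicity brings
    the product back to itself; so twice the trace is the sum of the contractions. *)
Lemma mxtrace_clifford4 a b c d :
  \tr (e a *m e b *m (e c *m e d)) =
  N%:R * ((a == b)%:R * (c == d)%:R - (a == c)%:R * (b == d)%:R
          + (a == d)%:R * (b == c)%:R).
Proof.
have step1 := mxtrace_swap a b (e c *m e d).
have step2 := mxtrace_swap a c (e d *m e b).
have step3 := mxtrace_swap a d (e b *m e c).
(* Cyclicity of the trace, to bring e a back to the front after each swap. *)
have rot2 : \tr (e b *m e a *m (e c *m e d)) = \tr (e a *m e c *m (e d *m e b)).
  by rewrite -!mulmxA mxtrace_mulC !mulmxA.
have rot3 : \tr (e c *m e a *m (e d *m e b)) = \tr (e a *m e d *m (e b *m e c)).
  by rewrite -!mulmxA mxtrace_mulC !mulmxA.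
have rot1 : \tr (e d *m e a *m (e b *m e c)) = \tr (e a *m e b *m (e c *m e d)).
  by rewrite -!mulmxA mxtrace_mulC !mulmxA.
rewrite rot2 step2 rot3 step3 rot1 !mxtrace_clifford2 in step1.
apply: (@mulfI _ 2); first by rewrite pnatr_eq0.
move: step1; rewrite (eq_sym d b) => step1.
rewrite mulr_natl mulr2n {1}step1; ring.
Qed.

Lemma sum_delta (x : 'I_n -> F) c : \sum_a x a * (a == c)%:R = x c.
Proof.
by rewrite (bigD1 c) //= eqxx mulr1 big1 ?addr0 // => a /negPf ->; rewrite mulr0.
Qed.

Lemma mxtrace_clifford_vec (x y : 'I_n -> F) c d : c != d ->
  \tr ((\sum_a x a *: e a) *m (\sum_b y b *: e b) *m (e c *m e d)) =
  N%:R * (x d * y c - x c * y d).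
Proof.
move=> /negPf cd; rewrite !mulmx_suml linear_sum /=.
transitivity (\sum_a N%:R * (x a * (a == d)%:R * y c - x a * (a == c)%:R * y d)).
  apply: eq_bigr => a _; rewrite mulmx_sumr mulmx_suml linear_sum /=.
  transitivity (\sum_b N%:R * (x a * (a == d)%:R * (y b * (b == c)%:R)
                              - x a * (a == c)%:R * (y b * (b == d)%:R))).
    apply: eq_bigr => b _.
    rewrite -!(scalemxAl, scalemxAr) !linearZ /= mxtrace_clifford4 cd
      [false%:R]/(0%:R) mulr0; ring.
  by rewrite -big_distrr sumrB -!big_distrr /= !sum_delta.
by rewrite -big_distrr sumrB -!big_distrl /= !sum_delta.
Qed.

End Trace.

Theorem proposition3p4 (R : realType) (n : nat) (hn : (2 <= n)%N)
    (p q : 'I_n) (hpq : (p < q)%N) (X Y : 'rV[R]_n) :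
  eta (phi0 R n) p q X Y
  = 2 ^+ n./2 * wedge_form (stdvec R p) (stdvec R q) X Y.
Proof.
pose B := gen R n p *m gen R n q.
have pq : (q == p) = false by apply/eqP => qp; rewrite qp ltnn in hpq.
have commB : gamma_mx R n *m map_mx Num.conj B = B *m gamma_mx R n.
  rewrite map_mxM mulmxA gamma_gen // -scalemxAl -mulmxA gamma_gen //.
  by rewrite -scalemxAr scalerA -expr2 sqrr_sign scale1r mulmxA.
have adjB : adjmx B = gen R n q *m gen R n p.
  by rewrite adjmxM !adj_gen mulNmx mulmxN opprK.
rewrite /eta (hermdot_phi0 (represents_wedge X Y)
  (represents_comp (represents_gen (R := R) p) (represents_gen (R := R) q)) commB) adjB.
have clif := @gen_clifford R n.
have stdE (v : 'I_n) (Z : 'rV[R]_n) : dotv (stdvec R v) Z = Z 0 v.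
  rewrite /dotv (bigD1 v) //= mxE !eqxx mul1r big1 ?addr0 // => a av.
  by rewrite mxE (negPf av) andbF mul0r.
rewrite /wedge_form !stdE.
have tr4 := mxtrace_clifford_vec clif
  (fun a => (X 0 a)%:C%C) (fun a => (Y 0 a)%:C%C) (negbT pq).
have tr2 := mxtrace_clifford2 clif q p.
rewrite mulmxDl -[(_ *: 1%:M) *m _]scalemxAl mul1mx mxtraceD mxtraceZ tr2 tr4 pq.
rewrite mulr0 oppr0 mulr0 addr0.
rewrite card_ffun !card_ord -!rmorphM -rmorphB
  -(rmorph_nat (real_complex R)) -rmorphM /=.
by rewrite natrX; ring.
Qed.
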